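(* Let $k$ be an algebraically closed field of characteristic $p>0$, let $(\mathfrak{g},[p])$ be a finite-dimensional $p$-trivial restricted Lie algebra over $k$ (i.e. $x^{[p]}=0$ for all $x\in\mathfrak{g}$), and let $M$ be a finite-dimensional $U_0(\mathfrak{g})$-module of constant rank. If there exist linearly independent elements $x,y\in\mathfrak{g}\setminus\{0\}$ such that $\mathrm{im}\,x_M=\mathrm{im}\,y_M$, then $M$ has the equal images property.
   Context: $U_0(\mathfrak{g})=U(\mathfrak{g})/(\{x^p-x^{[p]} : x\in\mathfrak{g}\})$ is the restricted enveloping algebra. For $x\in\mathfrak{g}$, $x_M:M\to M$ is the operator $m\mapsto x.m$. For $p$-trivial $\mathfrak{g}$: $M$ has constant rank if $\mathrm{rk}(x_M)=\mathrm{rk}(y_M)$ for all $x,y\in\mathfrak{g}\setminus\{0\}$; $M$ has the equal images property if $\mathrm{im}\,x_M^j=\mathrm{im}\,y_M^j$ for all $x,y\in\mathfrak{g}\setminus\{0\}$ and all $j\in\{1,\ldots,p-1\}$. *)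

(* Defs.v *)
From HB Require Import structures.
From mathcomp Require Import all_boot all_order all_algebra.
From mathcomp Require Import generic_quotient boolp.

Set Implicit Arguments.
Unset Strict Implicit.
Unset Printing Implicit Defensive.

Import GRing.Theory.
Local Open Scope ring_scope.
Local Open Scope quotient_scope.

(* The tensor algebra T(V): formal expressions over V modulo the smallest
   congruence containing the axioms of unital associative k-algebras and the
   linearity of the generators. *)
Inductive tterm (k : fieldType) (V : lmodType k) : Type :=
  | TGen of V
  | TZero
  | TOne
  | TScale of k & tterm V
  | TAdd of tterm V & tterm V
  | TMul of tterm V & tterm V.
Arguments TZero {k V}.
Arguments TOne {k V}.

Inductive tcong (k : fieldType) (V : lmodType k) : tterm V -> tterm V -> Prop :=
  | tcong_refl t : tcong t t
  | tcong_sym t u : tcong t u -> tcong u t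
  | tcong_trans t u v : tcong t u -> tcong u v -> tcong t v
  | tcong_scale a t u : tcong t u -> tcong (TScale a t) (TScale a u)
  | tcong_add t t' u u' :
      tcong t t' -> tcong u u' -> tcong (TAdd t u) (TAdd t' u')
  | tcong_mul t t' u u' :
      tcong t t' -> tcong u u' -> tcong (TMul t u) (TMul t' u')
  | tcong_addA t u v : tcong (TAdd t (TAdd u v)) (TAdd (TAdd t u) v)
  | tcong_addC t u : tcong (TAdd t u) (TAdd u t)
  | tcong_add0 t : tcong (TAdd TZero t) t
  | tcong_scale0 t : tcong (TScale 0 t) TZero
  | tcong_scale1 t : tcong (TScale 1 t) t
  | tcong_scaleA a b t : tcong (TScale a (TScale b t)) (TScale (a * b) t)
  | tcong_scaleDl a b t :
      tcong (TScale (a + b) t) (TAdd (TScale a t) (TScale b t))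
  | tcong_scaleDr a t u :
      tcong (TScale a (TAdd t u)) (TAdd (TScale a t) (TScale a u))
  | tcong_mulA t u v : tcong (TMul t (TMul u v)) (TMul (TMul t u) v)
  | tcong_mul1l t : tcong (TMul TOne t) t
  | tcong_mul1r t : tcong (TMul t TOne) t
  | tcong_mulDl t u v : tcong (TMul (TAdd t u) v) (TAdd (TMul t v) (TMul u v))
  | tcong_mulDr t u v : tcong (TMul t (TAdd u v)) (TAdd (TMul t u) (TMul t v))
  | tcong_scaleAl a t u : tcong (TScale a (TMul t u)) (TMul (TScale a t) u)
  | tcong_scaleAr a t u : tcong (TScale a (TMul t u)) (TMul t (TScale a u))
  | tcong_gen a v w :
      tcong (TGen (a *: v + w)) (TAdd (TScale a (TGen v)) (TGen w)).

HB.instance Definition _ (k : fieldType) (V : lmodType k) :=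
  gen_eqMixin (tterm V).
HB.instance Definition _ (k : fieldType) (V : lmodType k) :=
  gen_choiceMixin (tterm V).

Section TensorAlgebra.
Variables (k : fieldType) (V : lmodType k).

Definition tcongb (t u : tterm V) : bool := `[< tcong t u >].

Lemma tcongb_refl : reflexive tcongb.
Proof. by move=> t; apply/asboolP; exact: tcong_refl. Qed.

Lemma tcongb_sym : symmetric tcongb.
Proof. by move=> t u; apply: asbool_equiv_eq; split; exact: tcong_sym. Qed.

Lemma tcongb_trans : transitive tcongb.
Proof.
move=> t u v /asboolP ut /asboolP tv.
by apply/asboolP; exact: tcong_trans ut tv.
Qed.

Canonical tcong_equiv := EquivRel tcongb tcongb_refl tcongb_sym tcongb_trans.

Definition tensor_alg := {eq_quot tcong_equiv}.
HB.instance Definition _ := Choice.on tensor_alg.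

Definition tpi (t : tterm V) : tensor_alg := \pi_tensor_alg t.

Lemma tpiP t u : tcong t u -> tpi t = tpi u.
Proof. by move=> tu; apply/eqmodP/asboolP. Qed.

Lemma tpi_inj t u : tpi t = tpi u -> tcong t u.
Proof. by move=> /eqmodP /asboolP. Qed.

Lemma tpi_repr (x : tensor_alg) : tpi (repr x) = x.
Proof. exact: reprK. Qed.

Lemma trepr_pi t : tcong (repr (tpi t)) t.
Proof. by apply: tpi_inj; rewrite tpi_repr. Qed.

Definition tadd (x y : tensor_alg) := tpi (TAdd (repr x) (repr y)).
Definition tmul (x y : tensor_alg) := tpi (TMul (repr x) (repr y)).
Definition tscale a (x : tensor_alg) := tpi (TScale a (repr x)).
Definition topp (x : tensor_alg) := tscale (-1) x.

Lemma tpiD t u : tpi (TAdd t u) = tadd (tpi t) (tpi u).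
Proof. by apply/tpiP/tcong_add; apply/tcong_sym/trepr_pi. Qed.

Lemma tpiM t u : tpi (TMul t u) = tmul (tpi t) (tpi u).
Proof. by apply/tpiP/tcong_mul; apply/tcong_sym/trepr_pi. Qed.

Lemma tpiZ a t : tpi (TScale a t) = tscale a (tpi t).
Proof. by apply/tpiP/tcong_scale; apply/tcong_sym/trepr_pi. Qed.

Lemma taddA : associative tadd.
Proof.
move=> x y z; rewrite -(tpi_repr x) -(tpi_repr y) -(tpi_repr z) -!tpiD.
exact/tpiP/tcong_addA.
Qed.

Lemma taddC : commutative tadd.
Proof.
by move=> x y; rewrite -(tpi_repr x) -(tpi_repr y) -!tpiD; apply/tpiP/tcong_addC.
Qed.

Lemma tadd0 : left_id (tpi TZero) tadd.
Proof. by move=> x; rewrite -(tpi_repr x) -!tpiD; apply/tpiP/tcong_add0. Qed.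

Lemma tscale1 : left_id 1 tscale.
Proof. by move=> x; rewrite -(tpi_repr x) -!tpiZ; apply/tpiP/tcong_scale1. Qed.

Lemma tscaleDl x : {morph tscale^~ x : a b / a + b >-> tadd a b}.
Proof.
by move=> a b; rewrite -(tpi_repr x) -!tpiZ -tpiD; apply/tpiP/tcong_scaleDl.
Qed.

Lemma taddN : left_inverse (tpi TZero) topp tadd.
Proof.
move=> x; rewrite -[X in tadd _ X]tscale1 /topp -tscaleDl addNr.
by rewrite -(tpi_repr x) -tpiZ; apply/tpiP/tcong_scale0.
Qed.

HB.instance Definition _ :=
  GRing.isZmodule.Build tensor_alg taddA taddC tadd0 taddN.

Lemma tmulA : associative tmul.
Proof.
move=> x y z; rewrite -(tpi_repr x) -(tpi_repr y) -(tpi_repr z) -!tpiM.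
exact/tpiP/tcong_mulA.
Qed.

Lemma tmul1l : left_id (tpi TOne) tmul.
Proof. by move=> x; rewrite -(tpi_repr x) -!tpiM; apply/tpiP/tcong_mul1l. Qed.

Lemma tmul1r : right_id (tpi TOne) tmul.
Proof. by move=> x; rewrite -(tpi_repr x) -!tpiM; apply/tpiP/tcong_mul1r. Qed.

Lemma tmulDl : left_distributive tmul tadd.
Proof.
move=> x y z; rewrite -(tpi_repr x) -(tpi_repr y) -(tpi_repr z).
by rewrite -(tpiD (repr x)) -!tpiM -tpiD; apply/tpiP/tcong_mulDl.
Qed.

Lemma tmulDr : right_distributive tmul tadd.
Proof.
move=> x y z; rewrite -(tpi_repr x) -(tpi_repr y) -(tpi_repr z).
by rewrite -(tpiD (repr y)) -!tpiM -tpiD; apply/tpiP/tcong_mulDr.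
Qed.

Fixpoint teval (B : algType k) (f : V -> B) (t : tterm V) : B :=
  match t with
  | TGen v => f v
  | TZero => 0
  | TOne => 1
  | TScale a u => a *: teval f u
  | TAdd u v => teval f u + teval f v
  | TMul u v => teval f u * teval f v
  end.

Lemma teval_cong (B : algType k) (f : V -> B) t u :
  linear f -> tcong t u -> teval f t = teval f u.
Proof.
move=> fL; elim=> //=.
- by move=> ? ? ? _ -> _ ->.
- by move=> ? ? ? _ ->.
- by move=> ? ? ? ? _ -> _ ->.
- by move=> ? ? ? ? _ -> _ ->.
- by move=> *; rewrite addrA.
- by move=> *; rewrite addrC.
- by move=> *; rewrite add0r.
- by move=> *; rewrite scale0r.
- by move=> *; rewrite scale1r.
- by move=> *; rewrite scalerA.
- by move=> *; rewrite scalerDl.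
- by move=> *; rewrite scalerDr.
- by move=> *; rewrite mulrA.
- by move=> *; rewrite mul1r.
- by move=> *; rewrite mulr1.
- by move=> *; rewrite mulrDl.
- by move=> *; rewrite mulrDr.
- by move=> *; rewrite scalerAl.
- by move=> *; rewrite scalerAr.
Qed.

Lemma tone_neq0 : tpi TOne != 0 :> tensor_alg.
Proof.
apply/eqP => /tpi_inj /(@teval_cong k^o (fun=> 0)) /= H.
have /eqP : (1 : k) = 0 by apply: H => a x y; rewrite scaler0 addr0.
by rewrite oner_eq0.
Qed.

HB.instance Definition _ := GRing.Zmodule_isNzRing.Build tensor_alg
  tmulA tmul1l tmul1r tmulDl tmulDr tone_neq0.

Lemma tscaleA a b (x : tensor_alg) : tscale a (tscale b x) = tscale (a * b) x.
Proof. by rewrite -(tpi_repr x) -!tpiZ; apply/tpiP/tcong_scaleA. Qed.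

Lemma tscaleDr : right_distributive tscale (+%R : _ -> _ -> tensor_alg).
Proof.
move=> a x y; rewrite -(tpi_repr x) -(tpi_repr y).
by rewrite -[tpi _ + tpi _]tpiD -!tpiZ -[RHS]tpiD; apply/tpiP/tcong_scaleDr.
Qed.

HB.instance Definition _ := GRing.Zmodule_isLmodule.Build k tensor_alg
  tscaleA tscale1 tscaleDr tscaleDl.

Lemma tscaleAl a (x y : tensor_alg) : a *: (x * y) = (a *: x) * y.
Proof.
rewrite -(tpi_repr x) -(tpi_repr y).
rewrite -[_ *: tpi _]tpiZ -![_ * _]tpiM -[LHS]tpiZ; exact/tpiP/tcong_scaleAl.
Qed.

Lemma tscaleAr a (x y : tensor_alg) : a *: (x * y) = x * (a *: y).
Proof.
rewrite -(tpi_repr x) -(tpi_repr y).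
rewrite -[_ *: tpi _]tpiZ -![_ * _]tpiM -[LHS]tpiZ; exact/tpiP/tcong_scaleAr.
Qed.

HB.instance Definition _ := GRing.Lmodule_isLalgebra.Build k tensor_alg tscaleAl.
HB.instance Definition _ := GRing.Lalgebra_isAlgebra.Build k tensor_alg tscaleAr.

Definition tgen (v : V) : tensor_alg := tpi (TGen v).

Lemma tensor_alg_lift (B : algType k) (f : V -> B) : linear f ->
  exists F : {lrmorphism tensor_alg -> B}, forall v, F (tgen v) = f v.
Proof.
move=> fL; pose F (x : tensor_alg) := teval f (repr x).
have Fpi t : F (tpi t) = teval f t by apply: teval_cong => //; apply: trepr_pi.
have FD : linear F.
  move=> a x y; rewrite -(tpi_repr x) -(tpi_repr y).
  by rewrite -[_ *: tpi _]tpiZ -[_ + _]tpiD !Fpi.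
have FM : monoid_morphism F.
  split; first exact: (Fpi TOne).
  by move=> x y; rewrite -(tpi_repr x) -(tpi_repr y) -[_ * _]tpiM !Fpi.
pose a1 := GRing.isLinear.Build _ _ _ _ F FD.
pose a2 := GRing.isMonoidMorphism.Build _ _ F FM.
pose F' : {lrmorphism tensor_alg -> B} := HB.pack F a1 a2.
by exists F' => v; apply: Fpi.
Qed.

End TensorAlgebra.

Inductive two_sided_ideal (A : pzRingType) (S : A -> Prop) : A -> Prop :=
  | tsi_gen a : S a -> two_sided_ideal S a
  | tsi_zero : two_sided_ideal S 0
  | tsi_add a b :
      two_sided_ideal S a -> two_sided_ideal S b -> two_sided_ideal S (a + b)
  | tsi_mull c a : two_sided_ideal S a -> two_sided_ideal S (c * a)
  | tsi_mulr c a : two_sided_ideal S a -> two_sided_ideal S (a * c).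

(* The quotient A / (S). Properness of the ideal (S) is a parameter because an
   algType is nontrivial by definition. *)
Section AlgebraQuotient.
Variables (k : fieldType) (A : algType k) (S : A -> Prop).
Hypothesis proper_S : ~ two_sided_ideal S 1.

Local Notation I := (two_sided_ideal S).

Lemma tsi_opp a : I a -> I (- a).
Proof. by move=> Ia; rewrite -mulN1r; exact: tsi_mull. Qed.

Definition qcongb (a b : A) : bool := `[< I (a - b) >].

Lemma qcongb_refl : reflexive qcongb.
Proof. by move=> a; apply/asboolP; rewrite subrr; exact: tsi_zero. Qed.

Lemma qcongb_sym : symmetric qcongb.
Proof.
by move=> a b; apply: asbool_equiv_eq; split=> /tsi_opp; rewrite opprB.
Qed.

Lemma qcongb_trans : transitive qcongb.
Proof.
move=> b a c /asboolP ab /asboolP bc; apply/asboolP.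
by rewrite -(subrKA b); exact: tsi_add.
Qed.

Canonical qcong_equiv := EquivRel qcongb qcongb_refl qcongb_sym qcongb_trans.

Definition alg_quot of ~ two_sided_ideal S 1 := {eq_quot qcong_equiv}.
Local Notation Q := (alg_quot proper_S).
HB.instance Definition _ := Choice.on Q.

Definition qproj (a : A) : Q := \pi_({eq_quot qcong_equiv}) a.
Definition qrepr (x : Q) : A := repr (x : {eq_quot qcong_equiv}).

Lemma qprojP a b : I (a - b) -> qproj a = qproj b.
Proof. by move=> ab; apply/eqmodP/asboolP. Qed.

Lemma qproj_inj a b : qproj a = qproj b -> I (a - b).
Proof. by move=> /eqmodP /asboolP. Qed.

Lemma qproj_repr x : qproj (qrepr x) = x.
Proof. exact: reprK. Qed.

Lemma qrepr_proj a : I (a - qrepr (qproj a)).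
Proof. by apply: qproj_inj; rewrite qproj_repr. Qed.

Definition qadd (x y : Q) := qproj (qrepr x + qrepr y).
Definition qmul (x y : Q) := qproj (qrepr x * qrepr y).
Definition qscale (c : k) (x : Q) := qproj (c *: qrepr x).
Definition qopp (x : Q) := qproj (- qrepr x).

Lemma qaddE a b : qproj (a + b) = qadd (qproj a) (qproj b).
Proof. by apply: qprojP; rewrite opprD addrACA; apply: tsi_add; exact: qrepr_proj. Qed.

Lemma qmulE a b : qproj (a * b) = qmul (qproj a) (qproj b).
Proof.
apply: qprojP; set a' := qrepr (qproj a); set b' := qrepr (qproj b).
have -> : a * b - a' * b' = (a - a') * b + a' * (b - b').
  by rewrite mulrBl mulrBr subrKA.
apply: tsi_add; [exact/tsi_mulr/qrepr_proj | exact/tsi_mull/qrepr_proj].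
Qed.

Lemma qscaleE c a : qproj (c *: a) = qscale c (qproj a).
Proof.
by apply: qprojP; rewrite -scalerBr -mulr_algl; exact/tsi_mull/qrepr_proj.
Qed.

Lemma qoppE a : qproj (- a) = qopp (qproj a).
Proof. by apply: qprojP; rewrite -opprD; exact/tsi_opp/qrepr_proj. Qed.

Lemma qaddA : associative qadd.
Proof.
move=> x y z; rewrite -(qproj_repr x) -(qproj_repr y) -(qproj_repr z).
by rewrite -!qaddE addrA.
Qed.

Lemma qaddC : commutative qadd.
Proof.
by move=> x y; rewrite -(qproj_repr x) -(qproj_repr y) -!qaddE addrC.
Qed.

Lemma qadd0 : left_id (qproj 0) qadd.
Proof. by move=> x; rewrite -(qproj_repr x) -!qaddE add0r. Qed.

Lemma qaddN : left_inverse (qproj 0) qopp qadd.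
Proof. by move=> x; rewrite -(qproj_repr x) -qoppE -!qaddE addNr. Qed.

HB.instance Definition _ := GRing.isZmodule.Build Q qaddA qaddC qadd0 qaddN.

Lemma qmulA : associative qmul.
Proof.
move=> x y z; rewrite -(qproj_repr x) -(qproj_repr y) -(qproj_repr z).
by rewrite -!qmulE mulrA.
Qed.

Lemma qmul1l : left_id (qproj 1) qmul.
Proof. by move=> x; rewrite -(qproj_repr x) -!qmulE mul1r. Qed.

Lemma qmul1r : right_id (qproj 1) qmul.
Proof. by move=> x; rewrite -(qproj_repr x) -!qmulE mulr1. Qed.

Lemma qmulDl : left_distributive qmul qadd.
Proof.
move=> x y z; rewrite -(qproj_repr x) -(qproj_repr y) -(qproj_repr z).
by rewrite -(qaddE (qrepr x)) -!qmulE -qaddE mulrDl.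
Qed.

Lemma qmulDr : right_distributive qmul qadd.
Proof.
move=> x y z; rewrite -(qproj_repr x) -(qproj_repr y) -(qproj_repr z).
by rewrite -(qaddE (qrepr y)) -!qmulE -qaddE mulrDr.
Qed.

Lemma qone_neq0 : qproj 1 != 0 :> Q.
Proof. by apply/eqP => /qproj_inj; rewrite subr0. Qed.

HB.instance Definition _ := GRing.Zmodule_isNzRing.Build Q
  qmulA qmul1l qmul1r qmulDl qmulDr qone_neq0.

Lemma qscaleA a b (x : Q) : qscale a (qscale b x) = qscale (a * b) x.
Proof. by rewrite -(qproj_repr x) -!qscaleE scalerA. Qed.

Lemma qscale1 : left_id 1 qscale.
Proof. by move=> x; rewrite -(qproj_repr x) -!qscaleE scale1r. Qed.

Lemma qscaleDr : right_distributive qscale (+%R : _ -> _ -> Q).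
Proof.
move=> a x y; rewrite -(qproj_repr x) -(qproj_repr y).
by rewrite -[qproj _ + qproj _]qaddE -!qscaleE -[RHS]qaddE scalerDr.
Qed.

Lemma qscaleDl (x : Q) : {morph qscale^~ x : a b / a + b >-> a + b}.
Proof.
by move=> a b; rewrite -(qproj_repr x) -!qscaleE -[RHS]qaddE scalerDl.
Qed.

HB.instance Definition _ := GRing.Zmodule_isLmodule.Build k Q
  qscaleA qscale1 qscaleDr qscaleDl.

Lemma qscaleAl c (x y : Q) : c *: (x * y) = (c *: x) * y.
Proof.
rewrite -(qproj_repr x) -(qproj_repr y).
rewrite -[c *: qproj _]qscaleE -[_ * _ in LHS]qmulE -[RHS]qmulE -[LHS]qscaleE.
by rewrite scalerAl.
Qed.

Lemma qscaleAr c (x y : Q) : c *: (x * y) = x * (c *: y).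
Proof.
rewrite -(qproj_repr x) -(qproj_repr y).
rewrite -[c *: qproj _]qscaleE -[_ * _ in LHS]qmulE -[RHS]qmulE -[LHS]qscaleE.
by rewrite scalerAr.
Qed.

HB.instance Definition _ := GRing.Lmodule_isLalgebra.Build k Q qscaleAl.
HB.instance Definition _ := GRing.Lalgebra_isAlgebra.Build k Q qscaleAr.

Lemma qproj_linear : linear qproj.
Proof. by move=> a x y; rewrite qaddE qscaleE. Qed.

Lemma qproj_monoid_morphism : monoid_morphism qproj.
Proof. by split=> // x y; rewrite qmulE. Qed.

HB.instance Definition _ := GRing.isLinear.Build k A Q _ qproj qproj_linear.
HB.instance Definition _ :=
  GRing.isMonoidMorphism.Build A Q qproj qproj_monoid_morphism.

Lemma tsi_ker (B : pzRingType) (f : {rmorphism A -> B}) :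
  (forall a, S a -> f a = 0) -> forall a, I a -> f a = 0.
Proof.
move=> fS a; elim=> [b /fS //||b c _ fb _ fc|c b _ fb|c b _ fb].
- exact: rmorph0.
- by rewrite rmorphD fb fc addr0.
- by rewrite rmorphM fb mulr0.
- by rewrite rmorphM fb mul0r.
Qed.

Lemma alg_quot_lift (B : algType k) (f : {lrmorphism A -> B}) :
  (forall a, S a -> f a = 0) ->
  exists F : {lrmorphism Q -> B}, forall a, F (qproj a) = f a.
Proof.
move=> fS; pose F (x : Q) := f (qrepr x).
have Fpi a : F (qproj a) = f a.
  apply/esym/eqP; rewrite -subr_eq0 -rmorphB; apply/eqP.
  exact: (tsi_ker fS (qrepr_proj a)).
have FL : linear F.
  move=> a x y; rewrite -(qproj_repr x) -(qproj_repr y).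
  by rewrite -linearP !Fpi linearP.
have FM : monoid_morphism F.
  split; first by rewrite -[1]/(qproj 1) Fpi rmorph1.
  by move=> x y; rewrite -(qproj_repr x) -(qproj_repr y) -rmorphM !Fpi rmorphM.
pose a1 := GRing.isLinear.Build _ _ _ _ F FL.
pose a2 := GRing.isMonoidMorphism.Build _ _ F FM.
pose F' : {lrmorphism Q -> B} := HB.pack F a1 a2.
by exists F' => a; apply: Fpi.
Qed.

End AlgebraQuotient.

(* jac_coef br x y n j is the coefficient of t^j in (ad (t x + y))^n (x). *)
Fixpoint jac_coef (V : zmodType) (br : V -> V -> V) (x y : V) (n j : nat) : V :=
  match n, j with
  | 0, 0 => x
  | 0, _.+1 => 0
  | n'.+1, 0 => br y (jac_coef br x y n' 0)
  | n'.+1, j'.+1 => br x (jac_coef br x y n' j') + br y (jac_coef br x y n' j)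
  end.

(* The last axiom is Jacobson's formula
   (x + y)^[p] = x^[p] + y^[p] + \sum_(0 < i < p) s_i(x, y), in which
   i s_i(x, y) is the coefficient of t^(i-1) in (ad (t x + y))^(p-1) (x). *)
Record restrictedLieAlg (k : fieldType) (p : nat) (charkp : p \in [pchar k])
  : Type := RestrictedLieAlg {
  rla_sort :> vectType k;
  bracket : rla_sort -> rla_sort -> rla_sort;
  pmap : rla_sort -> rla_sort;
  bracketDl : forall a x y z,
    bracket (a *: x + y) z = a *: bracket x z + bracket y z;
  bracketDr : forall a x y z,
    bracket z (a *: x + y) = a *: bracket z x + bracket z y;
  bracketxx : forall x, bracket x x = 0;
  jacobi : forall x y z,
    bracket x (bracket y z) + bracket y (bracket z x)
      + bracket z (bracket x y) = 0;
  ad_pmap : forall x y, bracket (pmap x) y = iter p (bracket x) y;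
  pmapZ : forall a x, pmap (a *: x) = a ^+ p *: pmap x;
  pmapD : forall x y, pmap (x + y) = pmap x + pmap y
    + \sum_(1 <= i < p) i%:R^-1 *: jac_coef bracket x y p.-1 i.-1
}.

Section EnvelopingAlgebras.
Variables (k : fieldType) (p : nat) (charkp : p \in [pchar k]).
Variable g : restrictedLieAlg charkp.

Variant uea_rel : tensor_alg g -> Prop :=
  UeaRel x y : uea_rel (tgen x * tgen y - tgen y * tgen x - tgen (bracket x y)).

Lemma tensor_alg_aug : exists2 F : {lrmorphism tensor_alg g -> k^o},
  forall x, F (tgen x) = 0 & forall a, uea_rel a -> F a = 0.
Proof.
have [|F Fg] := @tensor_alg_lift k g k^o (fun=> 0).
  by move=> a x y; rewrite scaler0 addr0.
by exists F => // _ [x y]; rewrite 2!raddfB /= Fg !rmorphM /= !Fg mulr0 !subr0.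
Qed.

Lemma uea_proper : ~ two_sided_ideal uea_rel 1.
Proof.
have [F _ FS] := tensor_alg_aug => /(tsi_ker FS) /eqP.
by rewrite rmorph1 oner_eq0.
Qed.

Definition uea : algType k := alg_quot uea_proper.

Definition uea_proj : {lrmorphism tensor_alg g -> uea} := qproj uea_proper.
Definition uea_gen (x : g) : uea := uea_proj (tgen x).

Variant u0_rel : uea -> Prop :=
  U0Rel x : u0_rel (uea_gen x ^+ p - uea_gen (pmap x)).

Lemma u0_proper : ~ two_sided_ideal u0_rel 1.
Proof.
have [F Fg FS] := tensor_alg_aug.
have [G GF] := alg_quot_lift uea_proper FS.
have GS a : u0_rel a -> G a = 0.
  case=> x; rewrite raddfB /= rmorphXn /= /uea_gen !GF !Fg subr0.
  by rewrite expr0n -[p]prednK ?prime_gt0 ?(pcharf_prime charkp).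
by move=> /(tsi_ker GS) /eqP; rewrite rmorph1 oner_eq0.
Qed.

Definition restricted_uea : algType k := alg_quot u0_proper.

Definition u0_proj : {lrmorphism uea -> restricted_uea} := qproj u0_proper.
Definition u0_gen (x : g) : restricted_uea := u0_proj (uea_gen x).

Lemma u0_gen_linear : linear u0_gen.
Proof.
move=> a x y; rewrite /u0_gen /uea_gen.
have -> : tgen (a *: x + y) = a *: tgen x + tgen y :> tensor_alg g.
  by rewrite -[_ *: tgen _]tpiZ -[RHS]tpiD; exact/tpiP/tcong_gen.
by rewrite !linearP.
Qed.

Lemma u0_gen_bracket x y :
  u0_gen (bracket x y) = u0_gen x * u0_gen y - u0_gen y * u0_gen x.
Proof.
rewrite /u0_gen.
have -> : uea_gen (bracket x y) = uea_gen x * uea_gen y - uea_gen y * uea_gen x.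
  rewrite /uea_gen -!rmorphM -rmorphB; apply/esym/qprojP.
  exact/tsi_gen/UeaRel.
by rewrite rmorphB !rmorphM.
Qed.

Lemma u0_gen_pmap x : u0_gen (pmap x) = u0_gen x ^+ p.
Proof.
by rewrite /u0_gen -rmorphXn; apply/esym/qprojP/tsi_gen/U0Rel.
Qed.

Lemma restricted_uea_lift (B : algType k) (f : g -> B) : linear f ->
    (forall x y, f (bracket x y) = f x * f y - f y * f x) ->
    (forall x, f (pmap x) = f x ^+ p) ->
  exists F : {lrmorphism restricted_uea -> B}, forall x, F (u0_gen x) = f x.
Proof.
move=> fL fbr fp; have [F0 F0E] := tensor_alg_lift fL.
have [|F1 F1E] := @alg_quot_lift _ _ _ uea_proper _ F0.
  by move=> _ [x y]; rewrite 2!raddfB /= !rmorphM /= !F0E fbr subrr.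
have [|F2 F2E] := @alg_quot_lift _ _ _ u0_proper _ F1.
  by move=> _ [x]; rewrite raddfB /= rmorphXn /= /uea_gen !F1E !F0E fp subrr.
by exists F2 => x; rewrite /u0_gen F2E /uea_gen F1E F0E.
Qed.

Definition p_trivial : Prop := forall x : g, pmap x = 0.

Record u0_module : Type := U0Module {
  u0m_sort :> vectType k;
  u0_act : restricted_uea -> 'End(u0m_sort);
  u0_act_linear : linear u0_act;
  u0_act1 : u0_act 1 = \1%VF;
  u0_actM : forall a b, u0_act (a * b) = (u0_act a \o u0_act b)%VF
}.

Variable M : u0_module.

Definition op (x : g) : 'End(M) := u0_act M (u0_gen x).

Definition op_exp (x : g) (j : nat) : 'End(M) :=
  iter j (comp_lfun (op x)) \1%VF.

Definition constant_rank : Prop :=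
  forall x y : g, x != 0 -> y != 0 -> \dim (limg (op x)) = \dim (limg (op y)).

Definition equal_images : Prop :=
  forall x y : g, x != 0 -> y != 0 -> forall j : nat, (0 < j < p)%N ->
    limg (op_exp x j) = limg (op_exp y j).

End EnvelopingAlgebras.

(* Main.v *)
Require Import Defs.
From mathcomp Require Import all_boot all_order all_algebra.
Local Open Scope ring_scope.

Set Implicit Arguments.
Unset Strict Implicit.
Unset Printing Implicit Defensive.

Import GRing.Theory.

(** Let [x], [y] be independent with [im x = im y = I]. By constant rank, every
nonzero [w] in the plane spanned by [x] and [y] has image [I], and any [z] maps
[ker w] into [im w = I], since otherwise [w + t z] would have larger rank for
generic [t]. The kernels of a pencil of surjections [M -> I] over an
algebraically closed field span [M] (dually, the images of a pencil of
injections intersect trivially), so [im z] lies in [I]. Hence all nonzero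
elements have the same image.

Since [ad x ^ p = ad x^[p] = 0], Engel's theorem provides a central [z <> 0],
and then [w^(j+1) M = w z^j M = z^j w M = z^j z M] by induction on [j]. *)

(** * Matrix pencils over an algebraically closed field *)

Section ConstantRank.
Variable F : closedFieldType.

Lemma closed_field_avoid (s : seq F) : exists t, t \notin s.
Proof.
have /closed_nonrootP [t] : \prod_(a <- s) ('X - a%:P) != 0 :> {poly F}.
  by rewrite monic_neq0 // monic_prod_XsubC.
by rewrite root_prod_XsubC; exists t.
Qed.

(** [D] is the matrix of [T] on the row space of [C] in the basis [B]; its characteristic polynomial
    has positive degree, hence a root. *)
Lemma stablemx_eigenvector n (C T : 'M[F]_n) : C != 0 -> stablemx C T ->
  exists (v : 'rV_n) (c : F), [/\ v != 0, (v <= C)%MS & v *m T = c *: v].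
Proof.
move=> C0 CT; pose B := row_base C.
have /submxP [D BT] : (B *m T <= B)%MS.
  by rewrite eq_row_base (eqmxMr T (eq_row_base C)).
have r0 : (0 < \rank C)%N by rewrite lt0n mxrank_eq0.
have /closed_rootP [c] : size (char_poly D) != 1.
  by rewrite size_char_poly; case: (\rank C) r0.
rewrite -eigenvalue_root_char => /eigenvalueP [u uD u0].
exists (u *m B), c; split.
- by rewrite mulmx_free_eq0 // row_base_free.
- by rewrite (submx_trans (submxMl _ _)) // eq_row_base.
- by rewrite -mulmxA BT mulmxA uD scalemxAl.
Qed.

(** If [u *m A = 0] and [u *m B] is outside the row space of [A], a basis of that row space together
    with [u *m B] forms an independent family [G]. Its perturbation [Gc] stays independent for
    suitable [c] and consists of combinations of rows of a single [A + t *: B], whose rank is then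
    too large. *)
Lemma rank_const_ker m n (A B : 'M[F]_(m, n)) :
  (forall t, (\rank (A + t *: B)%R <= \rank A)%N) ->
  (kermx A *m B <= A)%MS.
Proof.
move=> rkAB; apply/row_subP => i; rewrite row_mul.
set u := row i _; have uA : u *m A = 0 by apply/sub_kermxP; exact: row_sub.
apply: contraT => uB.
have /submxP [E EA] : (row_base A <= A)%MS by rewrite eq_row_base.
pose G := col_mx (row_base A) (u *m B).
have Gfree : row_free G.
  suff rkG : (\rank A < \rank G)%N.
    by rewrite /row_free eqn_leq rank_leq_row (leq_trans _ rkG) ?addn1.
  rewrite /G -addsmxE; apply: rank_ltmx; rewrite /ltmx.
  rewrite (submx_trans _ (addsmxSl _ _)) ?eq_row_base //=.
  by apply: contra uB; apply: submx_trans; exact: addsmxSr.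
(* A row [v] with [v *m Gc = 0] satisfies [v *m N = c *: v], so [c] must avoid the eigenvalues of
   [N]; the factor ['X] makes [c] invertible. *)
pose N : 'M_(\rank A + 1) := col_mx (E *m B) 0 *m pinvmx G.
have /closed_nonrootP [c] : char_poly N * 'X != 0.
  by rewrite mulf_neq0 ?polyX_eq0 // monic_neq0 // char_poly_monic.
rewrite rootM negb_or -eigenvalue_root_char rootX => /andP [Nc c0].
pose Gc : 'M_(\rank A + 1, n) := G - c^-1 *: col_mx (E *m B) 0.
have GcE : Gc = col_mx E (- c *: u) *m (A + (- c^-1) *: B).
  rewrite mul_col_mx !mulmxDr -!scalemxAl -!scalemxAr uA scaler0 add0r scalerA.
  rewrite mulrNN divff // scale1r -EA /Gc scale_col_mx scaler0 opp_col_mx oppr0.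
  by rewrite add_col_mx addr0 scaleNr.
have : row_free Gc.
  apply: inj_row_free => v; rewrite /Gc mulmxBr => /eqP; rewrite subr_eq0 => /eqP.
  move=> /(congr1 (fun X => c *: X *m pinvmx G)).
  rewrite -scalemxAr scalerA divff // scale1r -scalemxAl mulmxKp // => vN.
  apply/eqP; apply: contraNT Nc => v0; apply/eigenvalueP; exists v => //.
  by rewrite /N mulmxA -vN.
rewrite /row_free GcE => /eqP rk.
have := leq_trans (mxrankM_maxr _ _) (rkAB (- c^-1)).
by move=> /(_ _ (col_mx E (- c *: u))); rewrite rk addn1 ltnn.
Qed.

Lemma pencil_row_spaces_trivial r m q (P Q : 'M[F]_(r, m)) (v : 'M[F]_(q, m)) :
  (forall a b : F, (a != 0) || (b != 0) -> row_free (a *: P + b *: Q)) ->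
  (forall a b : F, (a != 0) || (b != 0) -> (v <= (a *: P + b *: Q)%R)%MS) ->
  v = 0.
Proof.
move=> PQfree vPQ.
pose C s := foldr (fun a D => (P + a *: Q)%R :&: D)%MS <<Q>>%MS s.
have subC s m' (w : 'M_(m', m)) :
    reflect ((w <= Q)%MS /\ forall a, a \in s -> (w <= (P + a *: Q)%R)%MS)
            (w <= C s)%MS.
  apply: (iffP idP).
    elim: s => [|a s IH] /=; first by rewrite genmxE.
    rewrite sub_capmx => /andP [wa /IH [wQ ws]]; split=> // b.
    by rewrite inE => /predU1P [->|/ws].
  elim: s => [[wQ _]|a s IH [wQ ws]] /=; first by rewrite genmxE.
  rewrite sub_capmx ws ?mem_head //= IH //; split=> // b bs.
  by rewrite ws // inE bs orbT.
have free1 t : row_free (P + t *: Q).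
  by rewrite -[P]scale1r PQfree // oner_neq0.
(* Enlarge [s] until the rank of [C s] stops dropping. *)
have [s [t [tNs Cst]]] : exists s t, t \notin s /\ (C s <= (P + t *: Q)%R)%MS.
  have [d] := ubnP (\rank (C [::])); elim: d [::] => // d IH s rks.
  have [t tNs] := closed_field_avoid s.
  have [Ct|CNt] := boolP (C s <= (P + t *: Q)%R)%MS; first by exists s, t.
  apply: (IH (t :: s)); rewrite ltnS in rks; apply: leq_trans rks.
  apply: rank_ltmx => /=; rewrite /ltmx capmxSr /=.
  by apply: contra CNt => /submx_trans; apply; exact: capmxSl.
have vC : (v <= C s)%MS.
  apply/subC; split=> [|a _].
    by rewrite -[Q]scale1r -[_ *: Q]add0r -(scale0r P) vPQ // oner_neq0 orbT.
  by rewrite -[P]scale1r vPQ // oner_neq0.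
(* Then [u *m W |-> u *m Q] maps [C s] to itself, and for an eigenvector
   [u *m W] the row [u] is killed by a nonzero member of the pencil. *)
pose W := P + t *: Q; pose T := pinvmx W *m Q.
have TE w : (w <= C s)%MS -> exists2 u, w = u *m W & w *m T = u *m Q.
  move=> /submx_trans /(_ Cst) /submxP [u wu]; exists u => //.
  by rewrite wu /T mulmxA mulmxKp.
have [C0|C0] := eqVneq (C s) 0; first by move: vC; rewrite C0 submx0 => /eqP.
have Cstable : stablemx (C s) T.
  apply/row_subP => i; rewrite row_mul.
  have wC : (row i (C s) <= C s)%MS by exact: row_sub.
  have [u wu ->] := TE _ _ wC; apply/subC; split=> [|a as_]; first exact: submxMl.
  have [_ /(_ a as_)] := elimT (subC _ _ _) wC; rewrite wu.
  (* Since [u *m W] lies in the row space of [P + a *: Q], so does [(t - a) *: (u *m Q)], and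
     [t != a] because [t] is not in [s]. *)
  have -> : W = (P + a *: Q) + (t - a) *: Q.
    by rewrite scalerBl -addrA [_ + (_ - _)]addrC subrK.
  rewrite mulmxDr => H.
  have ta : t - a != 0 by rewrite subr_eq0; apply: contraNneq tNs => ->.
  rewrite -[u *m Q](scalerK ta) scalemx_sub // scalemxAr.
  rewrite -(addKr (u *m (P + a *: Q)) (_ *m _)) addmx_sub // -scaleN1r.
  by rewrite scalemx_sub // submxMl.
have [w [c [w0 wC wT]]] := stablemx_eigenvector C0 Cstable.
have [u wu] := TE _ _ wC; rewrite wT => uQ.
(* [u *m Q = c *: (u *m (P + t *: Q))] says that this combination kills [u]; if [c = 0], its
   coefficient at [Q] is 1. *)
have free2 : row_free ((- c) *: P + (1 - c * t) *: Q).
  apply: PQfree; rewrite oppr_eq0; case: eqVneq => //= ->.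
  by rewrite mul0r subr0 oner_neq0.
case/negP: w0; rewrite wu.
suff -> : u = 0 by rewrite mul0mx.
apply/eqP; rewrite -(mulmx_free_eq0 _ free2) mulmxDr -!scalemxAr scalerBl.
move: uQ; rewrite wu /W mulmxDr -scalemxAr scalerDr scalerA => uQ.
by rewrite scale1r scaleNr addrCA -opprD uQ subrr.
Qed.

(** Matrices act on row vectors, so images are row spaces. For [w] in the plane of [x] and [y],
    [D w] is [A w] in coordinates on the row space of [A x], and [X] is [A z] modulo that row space.
    [X] vanishes on the kernel of each nonzero [w] in the plane, so it factors through [D w];
    transposing, its row space lies in those of a pencil of injections. *)
Lemma constant_rank_same_row_space n (V : lmodType F) (A : V -> 'M[F]_n)
    r x y z :
    linear A -> (forall w, w != 0 -> \rank (A w) = r) ->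
    (forall a b : F, (a != 0) || (b != 0) -> a *: x + b *: y != 0) ->
    (A y <= A x)%MS -> (A z <= A x)%MS.
Proof.
move=> Alin rkA xy Ayx.
have A0 : A 0 = 0.
  by have := Alin (-1) 0 0; rewrite scaler0 addr0 scaleN1r addNr.
have AE a b u v : A (a *: u + b *: v) = a *: A u + b *: A v.
  by rewrite Alin -[b *: v]addr0 Alin A0 addr0.
have kerA w : w != 0 -> (kermx (A w) *m A z <= A w)%MS.
  move=> w0; apply: rank_const_ker => t; rewrite (rkA w) // -[A w]scale1r -AE.
  have [->|u0] := eqVneq (1 *: w + t *: z) 0; last by rewrite rkA.
  by rewrite A0 mxrank0.
pose R := row_base (A x); pose D w := A w *m pinvmx R.
have AD a b : D (a *: x + b *: y) *m R = A (a *: x + b *: y).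
  by rewrite /D mulmxKpV // AE eq_row_base addmx_sub // scalemx_sub.
have DE a b : D (a *: x + b *: y) = a *: D x + b *: D y.
  by rewrite /D AE mulmxDl -!scalemxAl.
have Dfull a b : (a != 0) || (b != 0) -> row_full (D (a *: x + b *: y)).
  move=> ab; rewrite /row_full eqn_leq rank_leq_col /=.
  have x0 : x != 0.
    by have := xy 1 0; rewrite scale1r scale0r addr0 oner_neq0; apply.
  by apply: leq_trans (mxrankM_maxl _ R); rewrite AD !rkA ?xy.
have DtE a b : a *: (D x)^T + b *: (D y)^T = (D (a *: x + b *: y))^T.
  by rewrite DE linearD !linearZ.
rewrite submxE -trmx_eq0; set X := A z *m _; apply/eqP.
apply: (@pencil_row_spaces_trivial _ _ _ (D x)^T (D y)^T) => a b ab.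
  by rewrite DtE /row_free mxrank_tr; exact: Dfull.
rewrite DtE; set w := _ + _.
suff -> : X = D w *m (pinvmx (D w) *m X).
  by rewrite [X in (X <= _)%MS]trmx_mul submxMl.
apply/eqP; rewrite mulmxA -subr_eq0 -{1}[X]mul1mx -mulmxBl; set K := 1%:M - _.
(* The rows of [K] are killed by [D w], hence by [A w]; so [A z] sends them into the row space of
   [A w], inside that of [A x], and [K *m X = 0]. *)
have /submxP [E KE] : (K <= kermx (A w))%MS.
  apply/sub_kermxP; rewrite -AD -/w mulmxA mulmxBl mul1mx mulmxKpV //.
  by rewrite subrr mul0mx.
have Awx : (A w <= A x)%MS by rewrite AE addmx_sub // scalemx_sub.
rewrite /X mulmxA -submxE KE -mulmxA.
by rewrite (submx_trans (submxMl _ _)) // (submx_trans (kerA _ (xy _ _ ab))).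
Qed.

End ConstantRank.

(** * Images of linear maps as row spaces of matrices *)

Section LinearImages.
Import VectorInternalTheory.
Variables (F : fieldType) (U V : vectType F).

Lemma f2mx_is_linear : linear (f2mx : 'Hom(U, V) -> _).
Proof.
move=> a f h; rewrite -[RHS]/(f2mx (Hom _)); congr f2mx.
by apply/lfunP => v; rewrite add_lfunE scale_lfunE !unlock /= linearP linearP.
Qed.

Lemma limg_mx2vs (f : 'Hom(U, V)) : limg f = mx2vs (f2mx f).
Proof.
rewrite unlock; apply: val_inj => /=; apply/genmxP.
by apply/eqmxP/(eqmx_trans (eqmxMr _ (genmxE _))); rewrite mul1mx.
Qed.

Lemma limg_f2mx_sub (f h : 'Hom(U, V)) :
  (limg f <= limg h)%VS = (f2mx f <= f2mx h)%MS.
Proof. by rewrite !limg_mx2vs /subsetv /= !genmxE. Qed.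

Lemma dim_limg_f2mx (f : 'Hom(U, V)) : \dim (limg f) = \rank (f2mx f).
Proof. by rewrite limg_mx2vs /dimv /= genmxE. Qed.

End LinearImages.

(** * Engel's theorem and central elements *)

Section Engel.
Variables (F : fieldType) (L : vectType F) (br : L -> L -> L).
Hypothesis brDl : forall a x y z, br (a *: x + y) z = a *: br x z + br y z.
Hypothesis brDr : forall a x y z, br z (a *: x + y) = a *: br z x + br z y.
Hypothesis brxx : forall x, br x x = 0.
Hypothesis br_jacobi : forall x y z,
  br x (br y z) + br y (br z x) + br z (br x y) = 0.
Hypothesis ad_nilpotent : forall x y, exists n, iter n (br x) y = 0.

Let brC x y : br x y = - br y x.
Proof.
apply/eqP; rewrite -subr_eq0 opprK; apply/eqP; have := brxx (1 *: x + y).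
by rewrite brDl !brDr !brxx !scale1r add0r addr0.
Qed.

Let br0 x : br x 0 = 0.
Proof.
by have := brDr (-1) 0 0 x; rewrite scaler0 addr0 scaleN1r addNr.
Qed.

Let br_derivation x y z : br x (br y z) = br y (br x z) + br (br x y) z.
Proof.
have brN u v : br u (- v) = - br u v.
  by rewrite -scaleN1r -[_ *: v]addr0 brDr br0 addr0 scaleN1r.
apply/eqP; rewrite -subr_eq0 -(br_jacobi x y z) opprD addrA.
by rewrite (brC z x) brN (brC z (br _ _)).
Qed.

(* [K] kills a nonzero vector of every nonzero quotient representation [L / U]. *)
Definition ad_kills_mod (K : {vspace L}) := forall U : {vspace L},
  U != fullv -> (forall a u, a \in K -> u \in U -> br a u \in U) ->
  exists2 v, v \notin U & forall a, a \in K -> br a v \in U.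

(** Let [K] kill [v] modulo [U]. Applying [br h] preserves this, as [br a (br h v) = br h (br a v) +
    br (br a h) v], and the iterate just before the first one in [U] is killed by [h] as well. *)
Lemma ad_kills_mod_extend (K : {vspace L}) h : ad_kills_mod K ->
  (forall a, a \in K -> br a h \in K) -> ad_kills_mod (K + <[h]>).
Proof.
move=> PK Kh U Ufull Ust.
have hK' : h \in (K + <[h]>)%VS by rewrite (subvP (addvSr _ _)) ?memv_line.
have KK' a : a \in K -> a \in (K + <[h]>)%VS by apply/subvP/addvSl.
have [|v vU Kv] := PK U Ufull; first by move=> a u /KK'; exact: Ust.
have hv : exists n, iter n (br h) v \in U.
  by have [n hn] := ad_nilpotent h v; exists n; rewrite hn mem0v.
case: (ex_minnP hv) => -[|n]; first by rewrite /= (negPf vU).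
move=> hnU nmin; exists (iter n (br h) v).
  by apply/negP => /nmin; rewrite ltnn.
move=> _ /memv_addP [a aK [_ /vlineP [c ->] ->]].
rewrite addrC brDl rpredD ?rpredZ //.
elim: n {nmin hnU} a aK => [|n IH] a aK /=; first exact: Kv.
by rewrite br_derivation rpredD ?IH ?Kh // Ust ?IH.
Qed.

(* [K] acts on [L / K], so it kills some [h] there, and [K + <[h]>] is again a
   subalgebra. *)
Lemma engel : ad_kills_mod fullv.
Proof.
suff grow n (K : {vspace L}) : (\dim {:L} - \dim K < n)%N ->
    (forall a b, a \in K -> b \in K -> br a b \in K) ->
    ad_kills_mod K -> ad_kills_mod fullv.
  apply: (grow _ 0%VS (ltnSn _)) => [a b _|U Ufull _].
    by rewrite !memv0 => /eqP ->; rewrite br0.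
  have /subvPn [v _ vU] : ~~ ({:L} <= U)%VS.
    by apply: contra Ufull => H; rewrite eqEsubv subvf.
  by exists v => // a; rewrite memv0 => /eqP ->; rewrite brC br0 oppr0 mem0v.
elim: n K => // n IH K; rewrite ltnS => dimK Ksub PK.
have [<-//|Kfull] := eqVneq K fullv.
have [h hK Kh] := PK K Kfull Ksub.
apply: (IH (K + <[h]>)%VS); last exact: ad_kills_mod_extend.
  have ltK : (\dim K < \dim (K + <[h]>))%N.
    rewrite (ltn_leqif (dimv_leqif_sup (addvSl _ _))) subv_add subvv /=.
    by rewrite -memvE.
  apply: leq_trans dimK; rewrite ltn_sub2l // (leq_trans ltK) //.
  exact/dimvS/subvf.
move=> a1 b1 /memv_addP [a aK [_ /vlineP [c ->] ->]].
move=> /memv_addP [b bK [_ /vlineP [d ->] ->]].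
(* The bracket lands in [K] itself: the term in [br h h] vanishes, and bracketing with [h] maps [K]
   into [K]. *)
apply: (subvP (addvSl _ _)).
rewrite addrC brDl [b + _]addrC !brDr brxx scaler0 add0r (brC h b).
by apply: rpredD; last apply: rpredD; rewrite ?rpredZ ?rpredN ?Kh ?Ksub.
Qed.

(** This is Engel's theorem with [U = 0], a proper subspace because of [x]. *)
Lemma engel_center (x : L) : x != 0 ->
  exists2 z, z != 0 & forall a, br a z = 0.
Proof.
move=> x0; have [|a u _|z] := engel (U := 0%VS).
- apply: contra x0 => /eqP full0; have := memvf x.
  by rewrite -full0 memv0.
- by rewrite !memv0 => /eqP ->; rewrite br0.
rewrite memv0 => z0 az; exists z => // a.
by apply/eqP; rewrite -memv0 az ?memvf.
Qed.

End Engel.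

(** * Images of the operators on a module *)

Section Images.
Variables (k : closedFieldType) (p : nat) (charkp : p \in [pchar k]).
Variables (g : restrictedLieAlg charkp) (M : u0_module g).

Lemma op_linear : linear (op M).
Proof. by move=> a x y; rewrite /op u0_gen_linear u0_act_linear. Qed.

Lemma op_comm x z : bracket x z = 0 -> (op M x \o op M z = op M z \o op M x)%VF.
Proof.
move=> xz; rewrite /op -!u0_actM; congr u0_act; apply/eqP.
rewrite -subr_eq0 -u0_gen_bracket xz.
have := u0_gen_linear (g := g) (-1) 0 0.
by rewrite scaler0 addr0 scaleN1r addNr => ->.
Qed.

Lemma constant_rank_same_image x y z : constant_rank M -> free [:: x; y] ->
  (limg (op M y) <= limg (op M x))%VS -> (limg (op M z) <= limg (op M x))%VS.
Proof.
move=> crM xyfree.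
have xy0 a b : (a != 0) || (b != 0) -> a *: x + b *: y != 0.
  move: xyfree; rewrite free_cons seq1_free => /andP [xy y0].
  apply: contraTneq => axby; have [a0|a0] := eqVneq a 0; last first.
    case/negP: xy; rewrite span_seq1 -[x](scalerK a0) memvZ //.
    move/eqP: axby; rewrite addr_eq0 => /eqP ->.
    by rewrite memvN memvZ ?memv_line.
  move: axby; rewrite a0 scale0r add0r => /eqP.
  by rewrite scaler_eq0 (negPf y0) orbF /= negbK.
rewrite !limg_f2mx_sub.
pose A w := VectorInternalTheory.f2mx (op M w).
apply: (@constant_rank_same_row_space _ _ _ A (\rank (A x))) => // [a u v|w w0].
  by rewrite /A op_linear f2mx_is_linear.
rewrite /A -!dim_limg_f2mx; apply: crM => //.
by have := xy0 1 0; rewrite scale1r scale0r addr0 oner_neq0; apply.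
Qed.

Lemma op_exp_image x z : bracket x z = 0 -> limg (op M x) = limg (op M z) ->
  forall j, limg (op_exp M x j) = limg (op_exp M z j).
Proof.
move=> xz same; elim=> // j IH.
have comm_exp w : (op M w \o op M z = op M z \o op M w)%VF ->
    (op M w \o op_exp M z j = op_exp M z j \o op M w)%VF.
  move=> wz; rewrite /op_exp; elim: j {IH} => [|j IH] /=.
    by rewrite comp_lfun1l comp_lfun1r.
  by rewrite comp_lfunA wz -comp_lfunA IH comp_lfunA.
rewrite /op_exp !iterS -!/(op_exp _ _ _) limg_comp IH -limg_comp.
(* Moving one factor past [op_exp M z j] turns the two sides into the images under it of
   [limg (op M x)] and [limg (op M z)]. *)
by rewrite (comm_exp x (op_comm xz)) (comm_exp z erefl) !limg_comp same.
Qed.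

End Images.

Theorem proposition7p1 (k : closedFieldType) (p : nat)
    (charkp : p \in [pchar k]) (g : restrictedLieAlg charkp) (M : u0_module g) :
  p_trivial g -> constant_rank M ->
  (exists x y : g, [/\ x != 0, y != 0, free [:: x; y] &
                       limg (op M x) = limg (op M y)]) ->
  equal_images M.
Proof.
move=> ptriv crM [x [y [x0 y0 xyfree imxy]]] u v u0 v0 j _.
have same w : w != 0 -> limg (op M w) = limg (op M x).
  (* By constant rank the dimensions agree, so one inclusion suffices. *)
  move=> w0; apply/eqP; rewrite eqEdim (crM _ _ w0 x0) leqnn andbT.
  by apply: constant_rank_same_image xyfree _ => //; rewrite imxy.
have br0l w : bracket 0 w = 0 :> g.
  have := bracketDl (r := g) (-1) 0 0 w.
  by rewrite scaler0 addr0 scaleN1r addNr.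
have [|z z0 zcent] := engel_center (@bracketDl _ _ _ g) (@bracketDr _ _ _ g)
    (@bracketxx _ _ _ g) (@jacobi _ _ _ g) _ x0.
  by move=> a b; exists p; rewrite -ad_pmap ptriv br0l.
(* Both images are compared with that of the same power of the central [z]. *)
by rewrite (@op_exp_image _ _ _ _ _ u z) ?(@op_exp_image _ _ _ _ _ v z) // !same.
Qed.
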